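(* Let $G$ be a simple signed graph with underlying unsigned graph $\underline{G}$. The following statements hold. (i) If $\underline{G}$ is $K_4$-minor-free, then $\chi(G)\le 3$. (ii) If $G$ is a union of two forests (that is, if the edge arboricity satisfies $a'(\underline{G})\le 2$), then $\chi(G)\le 4$. (iii) For every integer $k\ge 1$, if the vertex arboricity satisfies $a(\underline{G})\le k$, then $\chi(G)\le 2k$.
   Context: All graphs are finite and nonempty. A signed graph $G$ is a graph in which each edge $e$ is labelled with a sign $\sigma(e)\in\{+1,-1\}$; its underlying unsigned graph, obtained by forgetting the signs, is denoted by $\underline{G}$, and $G$ is simple if $\underline{G}$ has no loops and no parallel edges. A proper colouring of $G$ is a mapping $\phi\colon V(G)\to\mathbb{Z}$ such that for each edge $e=uv$ of $G$ we have $\phi(u)\neq\sigma(e)\phi(v)$. For $n\ge1$ let $M_n=\{\pm1,\pm2,\ldots,\pm k\}$ if $n=2k$, and $M_n=\{0,\pm1,\pm2,\ldots,\pm k\}$ if $n=2k+1$. An $n$-colouring of $G$ is a proper colouring of $G$ using colours from $M_n$. The chromatic number $\chi(G)$ of a signed graph $G$ is the smallest $n\ge 1$ such that $G$ admits an $n$-colouring. The vertex arboricity $a(H)$ of a graph $H$ is the minimum number of subsets into which $V(H)$ can be partitioned so that each subset induces a forest. The edge arboricity $a'(H)$ of $H$ is the minimum number of forests into which $E(H)$ can be partitioned (equivalently, the minimum number of acyclic subgraphs whose union covers $E(H)$). *)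

(* Defs.v *)
From HB Require Import structures.
From mathcomp Require Import all_boot all_order all_algebra.
From mathcomp Require Import boolp.

Set Implicit Arguments.
Unset Strict Implicit.
Unset Printing Implicit Defensive.

Import Order.TTheory GRing.Theory Num.Theory.

Lemma exists_asbool (P : nat -> Prop) :
  (exists n, P n) -> exists n, (fun n => `[< P n >]) n.
Proof. by case=> n Pn; exists n; apply/asboolP. Qed.

Definition least (P : nat -> Prop) (exP : exists n, P n) : nat :=
  ex_minn (exists_asbool exP).

Lemma leastP (P : nat -> Prop) (exP : exists n, P n) :
  P (least exP) /\ forall n, P n -> least exP <= n.
Proof.
rewrite /least; case: ex_minnP => m /asboolP Pm minm; split=> // n Pn.
by apply: minm; apply/asboolP.
Qed.

Record graph (V : finType) := Graph {
  adj : rel V;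
  adj_sym : symmetric adj;
  adj_irr : irreflexive adj
}.

Definition edges (V : finType) (H : graph V) : {set {set V}} :=
  [set [set x.1; x.2] | x in [set x : V * V | adj H x.1 x.2]].

Lemma mem_edges (V : finType) (H : graph V) (u v : V) :
  ([set u; v] \in edges H) = adj H u v.
Proof.
apply/imsetP/idP => [[[x y]]|uv]; last by exists (u, v); rewrite ?inE.
rewrite inE /= => xy eq_e.
have xuv : x \in [set u; v] by rewrite eq_e set21.
have yuv : y \in [set u; v] by rewrite eq_e set22.
case/set2P: xuv yuv xy => -> /set2P[->|->] //; rewrite ?adj_irr //.
by rewrite adj_sym.
Qed.

Definition induced (V : finType) (H : graph V) (A : {set V}) : rel V :=
  [rel u v | [&& u \in A, v \in A & adj H u v]].

Definition edge_rel (V : finType) (F : {set {set V}}) : rel V :=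
  [rel u v | [set u; v] \in F].

(* For a symmetric irreflexive e: the list c enumerates the vertices of a cycle
   of length at least 3, in cyclic order and without repetition. *)
Definition is_forest (V : finType) (e : rel V) : Prop :=
  forall c : seq V, 2 < size c -> ~~ (cycle e c && uniq c).

Definition vertex_forest_partition (V : finType) (H : graph V) (k : nat) :=
  exists P : {set {set V}},
    [/\ partition P [set: V], #|P| = k &
        forall A, A \in P -> is_forest (induced H A)].

Lemma vertex_forest_partition_ex (V : finType) (H : graph V) :
  exists k, vertex_forest_partition H k.
Proof.
pose P := preim_partition (@id V) [set: V].
exists #|P|, P; split=> //; first exact: preim_partitionP.
move=> A /imsetP[x _ ->] [|a [|b c]] //= _.
apply/negP=> /andP[/andP[/and3P[]]]; rewrite !inE /= => /eqP<- /eqP<-.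
by rewrite adj_irr.
Qed.

Definition vertex_arboricity (V : finType) (H : graph V) : nat :=
  least (vertex_forest_partition_ex H).

Definition edge_forest_partition (V : finType) (H : graph V) (k : nat) :=
  exists P : {set {set {set V}}},
    [/\ partition P (edges H), #|P| = k &
        forall F, F \in P -> is_forest (edge_rel F)].

Lemma edge_forest_partition_ex (V : finType) (H : graph V) :
  exists k, edge_forest_partition H k.
Proof.
pose P := preim_partition (@id {set V}) (edges H).
exists #|P|, P; split=> //; first exact: preim_partitionP.
move=> F /imsetP[f _ ->] [|a [|b [|d c]]] //= _.
apply/negP=> /and4P[/and3P[]].
rewrite /edge_rel /= !inE => /andP[_ /eqP fab] /andP[_ /eqP fbd] _.
rewrite !negb_or => /and3P[_ ad _] /andP[bd _] _.
have : a \in [set b; d] by rewrite -fbd fab set21.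
rewrite !inE => /orP[/eqP ab|/eqP]; last by move/eqP; rewrite (negPf ad).
have : d \in [set a; b] by rewrite -fab fbd set22.
by rewrite !inE !(eq_sym d) (negPf ad) (negPf bd).
Qed.

Definition edge_arboricity (V : finType) (H : graph V) : nat :=
  least (edge_forest_partition_ex H).

Definition complete_graph (n : nat) : graph 'I_n :=
  @Graph 'I_n [rel i j | i != j] (fun i j => congr1 negb (eq_sym i j))
         (fun i => congr1 negb (eqxx i)).

Definition connected_in (V : finType) (H : graph V) (A : {set V}) : Prop :=
  forall u v, u \in A -> v \in A -> connect (induced H A) u v.

(* B is a family of branch sets of a K-minor in H: contracting each B w and
   deleting the remaining vertices and superfluous edges yields K. *)
Definition has_minor (V W : finType) (H : graph V) (K : graph W) : Prop :=
  exists B : W -> {set V},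
    [/\ forall w, B w != set0,
        forall w, connected_in H (B w),
        forall w w', w != w' -> [disjoint B w & B w'] &
        forall w w', adj K w w' ->
          exists u v, [/\ u \in B w, v \in B w' & adj H u v]].

Definition minor_free (V W : finType) (K : graph W) (H : graph V) : Prop :=
  ~ has_minor H K.

Local Open Scope ring_scope.

(* A simple signed graph.  An edge uv is the set {u, v}, so the sign is
   independent of the order of u and v; its values off the edges are
   irrelevant. *)
Record signed_graph (V : finType) := SignedGraph {
  underlying : graph V;
  sigma : {set V} -> int;
  sigmaP : forall e, e \in edges underlying -> (sigma e = 1) \/ (sigma e = -1)
}.

Definition proper_colouring (V : finType) (G : signed_graph V)
    (phi : V -> int) : Prop :=
  forall u v, adj (underlying G) u v -> phi u <> sigma G [set u; v] * phi v.

Definition colours (n : nat) : seq int :=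
  (if odd n then [:: 0] else [::]) ++
  flatten [seq [:: i%:Z; - i%:Z] | i <- iota 1 n./2].

Definition colouring (V : finType) (G : signed_graph V) (n : nat)
    (phi : V -> int) : Prop :=
  proper_colouring G phi /\ forall v, phi v \in colours n.

Definition colourable (V : finType) (G : signed_graph V) (n : nat) : Prop :=
  (1 <= n)%N /\ exists phi : V -> int, colouring G n phi.

Lemma colourable_ex (V : finType) (G : signed_graph V) :
  exists n, colourable G n.
Proof.
exists (#|V|.*2.+1); split=> //; exists (fun v => (enum_rank v).+1%:Z); split.
  move=> u v uv /(congr1 absz); rewrite abszM.
  have -> : `|sigma G [set u; v]|%N = 1%N.
    by case: (@sigmaP _ G [set u; v]) => [|->|->] //; rewrite mem_edges.
  rewrite mul1n !absz_nat => -[] /val_inj/enum_rank_inj eq_uv.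
  by move: uv; rewrite eq_uv adj_irr.
move=> v; rewrite /colours /= odd_double uphalf_double mem_cat.
apply/orP; right; apply/flattenP.
exists [:: (enum_rank v).+1%:Z; - (enum_rank v).+1%:Z]; last first.
  by rewrite inE eqxx.
apply/mapP; exists (enum_rank v).+1 => //.
by rewrite mem_iota /= add1n ltnS ltn_ord.
Qed.

Definition chromatic_number (V : finType) (G : signed_graph V) : nat :=
  least (colourable_ex G).

(* Main.v *)
Require Import Defs.
From mathcomp Require Import all_boot all_order all_algebra.
From mathcomp Require Import boolp zify.

Set Implicit Arguments.
Unset Strict Implicit.
Unset Printing Implicit Defensive.

Import GRing.Theory.

(* A vertex with at most d coloured neighbours forbids at most d colours, signs
   notwithstanding, so a d-degenerate signed graph can be coloured greedily from
   any d + 1 integers.  Forests are 1-degenerate, which gives (iii) by using the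
   colours i and -i on the i-th part.  A forest on n > 0 vertices has degree sum
   at most 2(n - 1), so a union of two forests is 3-degenerate, which gives (ii).
   For (i) one shows that a graph of minimum degree at least 3 has a K_4 minor.
   In a minor-minimal counterexample every edge lies in a triangle, and if it
   lies in only one then the apex of that triangle has degree 3; moreover every
   neighbourhood N(v) is a forest, as a cycle in it would give a wheel.  A leaf
   u of N(v) and its neighbour w in N(v) then yield a degree-3 vertex w whose
   neighbourhood is an induced path, and contracting part of this configuration
   contradicts minimality. *)

(** * Neighbourhoods within a set, and degeneracy *)

Definition nbr (V : finType) (e : rel V) (B : {set V}) (x : V) : {set V} :=
  [set y in B | e x y].

Lemma card_nbr (V : finType) (e : rel V) (B : {set V}) (x : V) :
  #|nbr e B x| = \sum_(y in B) e x y.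
Proof.
rewrite -sum1_card big_mkcond [RHS]big_mkcond; apply: eq_bigr => y _.
by rewrite inE; case: (y \in B); case: (e x y).
Qed.

Definition degenerate (V : finType) (e : rel V) (d : nat) (A : {set V}) :=
  forall B : {set V}, B \subset A -> B != set0 ->
    exists2 v, v \in B & #|nbr e B v| <= d.

(** * Forests *)

(** If every vertex of [B] had two neighbours in [B], a path in [B] could be prolonged at its head
    for ever: a neighbour of the head, other than the next vertex, that already lies on the path
    would close a cycle. *)
Lemma forest_degenerate (V : finType) (e : rel V) (A : {set V}) :
  symmetric e -> irreflexive e -> is_forest e -> degenerate e 1 A.
Proof.
move=> esym eirr fe B _ /set0Pn[x0 x0B].
apply: contrapT => noleaf.
have deg2 v : v \in B -> 1 < #|nbr e B v|.
  by move=> vB; rewrite ltnNge; apply/negP => dv; apply: noleaf; exists v.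
(* Such a path has [#|V| + 1] distinct vertices. *)
suff [x [p [_ up sp]]] : exists x p,
    [/\ path e x p && all (mem B) (x :: p), uniq (x :: p) & size p = #|V|].
  by have := max_card (mem (x :: p)); rewrite (card_uniqP up) /= sp ltnn.
elim: #|V| => [|n [x [p [/andP[pp /= /andP[xB pB]] up sp]]]].
  by exists x0, [::]; rewrite /= x0B.
have [/subsetPn[y]|sub] := boolP (~~ (nbr e B x \subset p)).
  rewrite inE => /andP[yB exy] yp.
  exists y, (x :: p); rewrite /= -/(mem B) esym exy pp yB xB pB /= sp; split=> //.
  rewrite in_cons negb_or yp andbT; move: up => /= ->; rewrite andbT.
  by apply: contraTneq exy => ->; rewrite eirr.
move: sub; rewrite negbK => /subsetP sub; case: p => [|z p] in pp pB up sp sub *.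
  have /card_gt0P[y /sub] : 0 < #|nbr e B x| by apply: ltnW; exact: deg2.
  by rewrite in_nil.
(* [z] follows [x] on the path; avoiding it makes the cycle from [x] through [z] to [y] have length
   at least 3. *)
have : 0 < #|nbr e B x :\ z|.
  by have := deg2 x xB; rewrite (cardsD1 z); case: (_ \in _) => /=; lia.
case/card_gt0P => y; rewrite !inE => /and3P[yz yB exy].
have := sub y; rewrite !inE yB exy (negPf yz) => /(_ isT) yp.
case/path.splitP: yp pp up => p1 p2; rewrite -!cat_cons => pp up.
have {}up : uniq ((x :: z :: rcons p1 y) ++ p2) := up.
have /negP[] : ~~ (cycle e (x :: z :: rcons p1 y) && uniq (x :: z :: rcons p1 y)).
  by apply: fe; rewrite /= size_rcons.
move: pp up; rewrite cat_path cat_uniq => /andP[pp _] /andP[-> _].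
by rewrite andbT (cycle_path x) last_cons last_cons last_rcons -rcons_cons /= esym exy.
Qed.

Lemma sum_nbr_setD1 (V : finType) (e : rel V) (B : {set V}) (v : V) :
  symmetric e -> irreflexive e -> v \in B ->
  \sum_(x in B) #|nbr e B x| =
  (#|nbr e B v|).*2 + \sum_(x in B :\ v) #|nbr e (B :\ v) x|.
Proof.
move=> esym eirr vB; rewrite (big_setD1 v) //= -addnn -addnA; congr (_ + _).
have nbrD1 x : #|nbr e B x| = e x v + #|nbr e (B :\ v) x|.
  rewrite (cardsD1 v (nbr _ _ _)) inE vB; congr (_ + _); apply: eq_card => y.
  by rewrite !inE andbA.
under eq_bigr do rewrite nbrD1.
rewrite big_split /= nbrD1 eirr add0n; congr (_ + _).
by rewrite card_nbr; apply: eq_bigr => x _; rewrite esym.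
Qed.

(** Each induction step removes a vertex of degree at most 1, which lowers the degree sum by at most
    2. *)
Lemma forest_sum_nbr (V : finType) (e : rel V) (B : {set V}) :
  symmetric e -> irreflexive e -> is_forest e ->
  \sum_(x in B) #|nbr e B x| <= (#|B|.-1).*2.
Proof.
move=> esym eirr fe; move: {2}#|B| (leqnn #|B|) => n.
elim: n B => [|n IHn] B; first by rewrite leqn0 cards_eq0 => /eqP->; rewrite big_set0.
have [->|B0 leBn] := eqVneq B set0; first by rewrite big_set0.
have [v vB dv] := forest_degenerate esym eirr fe (subxx B) B0.
rewrite (sum_nbr_setD1 esym eirr vB).
have cB := cardsD1 v B; rewrite vB in cB.
have /IHn : #|B :\ v| <= n by lia.
(* For a singleton [B] the truncated [#|B|.-1] does not decrease; this bound then makes the degree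
   of [v] zero. *)
have : #|nbr e B v| <= #|B :\ v|.
  apply/subset_leq_card/subsetP => y; rewrite !inE => /andP[-> evy]; rewrite andbT.
  by apply: contraTneq evy => ->; rewrite eirr.
lia.
Qed.

(** Double counting: if all degrees in [B] were at least 2k, their sum would be at least 2k|B|,
    while k forests contribute at most 2k(|B| - 1). For k = 0 the clash is between |B| and 0. *)
Lemma edge_forests_degenerate (V : finType) (H : graph V) (k : nat) (A : {set V}) :
  edge_forest_partition H k -> degenerate (adj H) (k.*2.-1) A.
Proof.
case=> P [partP cP forP] B _ B0; apply: contrapT => large.
have deg v : v \in B -> k.*2.-1 < #|nbr (adj H) B v|.
  by move=> vB; rewrite ltnNge; apply/negP => dv; apply: large; exists v.
have Bpos : 0 < #|B| by rewrite card_gt0.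
have upper : \sum_(v in B) #|nbr (adj H) B v| <= k * (#|B|.-1).*2.
  rewrite -cP -sum_nat_const.
  apply: (@leq_trans (\sum_(F in P) \sum_(v in B) #|nbr (edge_rel F) B v|)).
    rewrite exchange_big; apply: leq_sum => v _.
    rewrite card_nbr; under [leqRHS]eq_bigr do rewrite card_nbr.
    rewrite exchange_big; apply: leq_sum => y _; case: (boolP (adj H v y)) => //.
    rewrite -mem_edges -(cover_partition partP) => /bigcupP[F FP vyF].
    by rewrite (big_setD1 F FP) /= {1}/edge_rel /= vyF.
  apply: leq_sum => F FP; apply: forest_sum_nbr (forP F FP).
    by move=> x y; rewrite /edge_rel /= setUC.
  move=> x; apply/negP => xF; have : [set x; x] \in cover P.
    by apply/bigcupP; exists F.
  by rewrite (cover_partition partP) mem_edges adj_irr.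
have lower : #|B| * k.*2.-1.+1 <= \sum_(v in B) #|nbr (adj H) B v|.
  by rewrite -sum_nat_const; apply: leq_sum => v /deg.
nia.
Qed.

(** * Minors and contractions *)

Lemma connect_trans3 (V : finType) (e : rel V) (x y z t : V) :
  connect e x y -> e y z -> connect e z t -> connect e x t.
Proof. by move=> xy /connect1 yz zt; apply: connect_trans xy (connect_trans yz zt). Qed.

Lemma induced_sym (V : finType) (H : graph V) (A : {set V}) :
  symmetric (induced H A).
Proof. by move=> x y; rewrite /induced /= adj_sym andbCA. Qed.

Lemma induced_irr (V : finType) (H : graph V) (A : {set V}) :
  irreflexive (induced H A).
Proof. by move=> x; rewrite /induced /= adj_irr !andbF. Qed.

Lemma connected_in_star (V : finType) (H : graph V) (A : {set V}) (c : V) :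
  c \in A -> (forall x, x \in A -> x != c -> adj H c x) -> connected_in H A.
Proof.
move=> cA star.
have cx x : x \in A -> connect (induced H A) c x.
  move=> xA; have [->|xc] := eqVneq x c; first exact: connect0.
  by apply: connect1; rewrite /induced /= cA xA star.
move=> x y xA yA; apply: connect_trans (cx y yA).
by rewrite (sym_connect_sym (induced_sym H A)) cx.
Qed.

Lemma has_minor_sub (V W : finType) (H1 H2 : graph V) (K : graph W) :
  subrel (adj H1) (adj H2) -> has_minor H1 K -> has_minor H2 K.
Proof.
move=> sub [B [Bn Bc Bd Be]]; exists B; split=> //.
  move=> w x y xB yB; apply: connect_sub (Bc w x y xB yB) => a b.
  by case/and3P=> aB bB /sub ab; apply: connect1; apply/and3P.
by move=> w w' /Be[x [y [xB yB /sub xy]]]; exists x, y.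
Qed.

Section ImageGraph.
Variables (V W : finType) (H : graph V) (f : V -> W).

Definition image_adj : rel W := [rel x y |
  (x != y) && [exists a, exists b, [&& f a == x, f b == y & adj H a b]]].

Lemma image_adjP x y : reflect (x != y /\ exists a b, [/\ f a = x, f b = y & adj H a b])
  (image_adj x y).
Proof.
apply: (iffP andP) => -[xy].
  by case/existsP=> a /existsP[b /and3P[/eqP ax /eqP by_ ab]]; split=> //; exists a, b.
case=> a [b [ax by_ ab]]; split=> //; apply/existsP; exists a; apply/existsP; exists b.
by rewrite ax by_ !eqxx.
Qed.

Lemma image_adj_sym : symmetric image_adj.
Proof.
suff imp x y : image_adj x y -> image_adj y x by move=> x y; apply/idP/idP; apply: imp.
case/image_adjP=> xy [a [b [ax by_ ab]]]; apply/image_adjP; rewrite eq_sym.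
by split=> //; exists b, a; rewrite adj_sym.
Qed.

Lemma image_adj_irr : irreflexive image_adj.
Proof. by move=> x; rewrite /image_adj /= eqxx. Qed.

Definition image_graph := Graph image_adj_sym image_adj_irr.

(* K has no isolated vertices because f need not be surjective: the preimage of
   a branch set could otherwise be empty. *)
Lemma image_graph_minor (U : finType) (K : graph U) :
    (forall x, connected_in H [set a | f a == x]) ->
    (forall w, exists w', adj K w w') ->
  has_minor image_graph K -> has_minor H K.
Proof.
move=> fibre Knoiso [B [_ Bc Bd Be]]; exists (fun w => f @^-1: B w); split.
- move=> w; have [w' /Be[x [y [xB _ /image_adjP[_ [a [b [ax _ _]]]]]]]] := Knoiso w.
  by apply/set0Pn; exists a; rewrite inE ax.
- move=> w a b; rewrite !inE => aB bB.
  have infibre x y : f x \in B w -> f x = f y ->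
      connect (induced H (f @^-1: B w)) x y.
    move=> xB fxy; have := fibre (f y) x y; rewrite !inE fxy eqxx => /(_ isT isT).
    apply: connect_sub => c d /and3P[]; rewrite !inE => /eqP cy /eqP dy cd.
    by apply: connect1; rewrite /induced /= !inE cy dy -fxy xB.
  have /connectP[p] := Bc w _ _ aB bB.
  (* A path of the image graph is lifted edge by edge: each edge comes from an edge [c d] of [H],
     and [infibre] joins consecutive lifts. *)
  elim: p a aB => [|x p IHp] a aB /=; first by move=> _ /esym; apply: infibre.
  case/andP=> /and3P[_ xB /image_adjP[_ [c [d [ca dx cd]]]]]; rewrite -dx => pp lp.
  apply: (@connect_trans3 _ _ _ c d); first by apply: infibre.
    by rewrite /induced /= !inE ca dx aB xB.
  by apply: IHp pp lp; rewrite dx.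
- move=> w w' /Bd; rewrite -!setI_eq0 => /eqP BI.
  by rewrite -preimsetI BI preimset0.
move=> w w' /Be[x [y [xB yB /image_adjP[_ [a [b [ax by_ ab]]]]]]].
by exists a, b; rewrite !inE ax by_.
Qed.

End ImageGraph.

Section Contract.
Variables (V : finType) (H : graph V).

Definition collapse (S : {set V}) (c : V) (x : V) : V := if x \in S then c else x.

Definition contract (S : {set V}) (c : V) : graph V := image_graph H (collapse S c).

Definition nb (x : V) : {set V} := [set y | adj H x y].

Lemma in_nb x y : (y \in nb x) = adj H x y.
Proof. by rewrite inE. Qed.

Variables (S : {set V}) (c : V).
Hypothesis sub_Sc : S \subset nb c.

Let adj_cS x : x \in S -> adj H c x.
Proof. by move/(subsetP sub_Sc); rewrite in_nb. Qed.

Let cNS : c \notin S.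
Proof. by apply/negP => /adj_cS; rewrite adj_irr. Qed.

(** The fibre over [c] is [S] together with [c], a star centred at [c]; every other fibre has at
    most one vertex. *)
Lemma contract_minor (W : finType) (K : graph W) :
  (forall w, exists w', adj K w w') -> has_minor (contract S c) K -> has_minor H K.
Proof.
apply: image_graph_minor => x; have [->|xc] := eqVneq x c.
  apply: (@connected_in_star _ _ _ c); first by rewrite inE /collapse (negPf cNS).
  move=> a; rewrite inE /collapse; case: ifP => [aS _ _|_ /eqP->]; first exact: adj_cS.
  by rewrite eqxx.
have fibre a : collapse S c a == x -> a = x.
  by rewrite /collapse; case: ifP => _ /eqP // cx; rewrite cx eqxx in xc.
by move=> a b; rewrite !inE => /fibre-> /fibre->; apply: connect0.
Qed.

Lemma contract_adj x y : x \notin S -> y \notin S -> adj H x y -> adj (contract S c) x y.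
Proof.
move=> xS yS xy; apply/image_adjP; split.
  by apply: contraTneq xy => ->; rewrite adj_irr.
by exists x, y; rewrite /collapse (negPf xS) (negPf yS).
Qed.

Lemma contract_adj_centre x s :
  x \notin S -> x != c -> s \in S -> adj H x s -> adj (contract S c) x c.
Proof.
move=> xS xc sS xs; apply/image_adjP; split=> //.
by exists x, s; rewrite /collapse (negPf xS) sS.
Qed.

(** This makes the number of non-isolated vertices drop when a nonempty [S] is contracted, which is
    the induction measure of [core_K4_minor]. *)
Lemma contract_support x y : adj (contract S c) x y -> x \notin S /\ nb x != set0.
Proof.
case/image_adjP=> _ [a [b [<- _ ab]]]; rewrite /collapse; case: ifP => [aS|aS].
  by split=> //; apply/set0Pn; exists a; rewrite in_nb adj_cS.
by rewrite aS; split=> //; apply/set0Pn; exists b; rewrite in_nb.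
Qed.

End Contract.

Lemma contract_edges (V : finType) (H : graph V) (S : {set V}) (c x : V) :
  S \subset nb H c -> x \notin S -> nb H x :\: S \subset nb (contract H S c) x.
Proof.
move=> sub_Sc xS; apply/subsetP => y; rewrite !inE => /andP[yS xy].
exact: contract_adj.
Qed.

(** Degree bookkeeping: a vertex with neighbours in [S] trades them all for the single neighbour
    [c]. *)
Lemma contract_edges_centre (V : finType) (H : graph V) (S : {set V}) (c x s : V) :
    S \subset nb H c -> x \notin S -> x != c -> s \in S -> adj H x s ->
  c |: (nb H x :\: S) \subset nb (contract H S c) x.
Proof.
move=> sub_Sc xS xc sS xs; rewrite subUset contract_edges // andbT sub1set in_nb.
exact: contract_adj_centre xs.
Qed.

(** * Producing K_4 minors *)

Lemma K4_minor (V : finType) (H : graph V) (s : seq {set V}) :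
    size s = 4 ->
    (forall A, A \in s -> A != set0 /\ connected_in H A) ->
    pairwise (fun A B : {set V} =>
      [disjoint A & B] && [exists x in A, exists y in B, adj H x y]) s ->
  has_minor H (complete_graph 4).
Proof.
move=> s4 sP /(pairwiseP set0) sdisj.
have mem_s (i : 'I_4) : nth set0 s i \in s by rewrite mem_nth ?s4.
have ltS (i : 'I_4) : (i : nat) \in gtn (size s) by rewrite inE s4.
have pairs (i j : 'I_4) : i < j -> _ := sdisj i j (ltS i) (ltS j).
exists (fun i : 'I_4 => nth set0 s i); split=> [i|i|i j ij|i j ij].
- by have [] := sP _ (mem_s i).
- by have [] := sP _ (mem_s i).
- have : (i < j) || (j < i) by rewrite -neq_ltn.
  case/orP => /pairs /andP[] //.
  by rewrite disjoint_sym.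
have : (i < j) || (j < i) by rewrite -neq_ltn.
case/orP => /pairs /andP[_] /exists_inP[x xA /exists_inP[y yB xy]].
  by exists x, y.
by exists y, x; rewrite adj_sym.
Qed.

Lemma connected_in_path (V : finType) (H : graph V) (x : V) (p : seq V) :
  path (adj H) x p -> connected_in H [set y in x :: p].
Proof.
move=> pp; have cx y : y \in x :: p -> connect (induced H [set y in x :: p]) x y.
  move=> yp; case/path.splitPl: yp pp => p1 p2 <-; rewrite cat_path => /andP[pp _].
  apply/connectP; exists p1 => //.
  apply: (@sub_in_path _ [in [set y in x :: p1 ++ p2]] (adj H)) pp.
    by move=> a b aA bA ab; rewrite /induced /= aA bA.
  by apply/allP => a ap; rewrite inE -cat_cons mem_cat ap.
move=> y z; rewrite !inE -!in_cons => yp zp; apply: connect_trans (cx z zp).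
by rewrite (sym_connect_sym (induced_sym H _)) cx.
Qed.

(** The branch sets are the hub, two consecutive rim vertices, and the rest of the rim, a path whose
    ends are adjacent to these two. *)
Lemma wheel_K4_minor (V : finType) (H : graph V) (v : V) (c : seq V) :
    2 < size c -> cycle (adj H) c -> uniq c -> {in c, forall x, adj H v x} ->
  has_minor H (complete_graph 4).
Proof.
case: c => [|c0 [|c1 [|c2 p]]] // _ cyc uc hub.
have vNc : v \notin [:: c0, c1, c2 & p].
  by apply/negP => /hub; rewrite adj_irr.
have /and4P[c01 c12 pp lc] : [&& adj H c0 c1, adj H c1 c2, path (adj H) c2 p & adj H (last c2 p) c0].
  by move: cyc; rewrite /= rcons_path.
apply: (@K4_minor _ _ [:: [set v]; [set c0]; [set c1]; [set x in c2 :: p]]) => //.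
  have conn1 x : [set x] != set0 /\ connected_in H [set x].
    split; first by apply/set0Pn; exists x; rewrite set11.
    by move=> a b /set1P-> /set1P->; apply: connect0.
  move=> A; rewrite !inE => /or4P[] /eqP->; rewrite ?conn1 //; split.
    by apply/set0Pn; exists c2; rewrite !inE eqxx.
  exact: connected_in_path.
have edge (A B : {set V}) x y : x \in A -> y \in B -> adj H x y ->
    [exists x in A, exists y in B, adj H x y].
  by move=> xA yB xy; apply/exists_inP; exists x => //; apply/exists_inP; exists y.
move: uc vNc; rewrite /= !disjoints1.
rewrite (edge [set v] [set c0] v c0) ?(edge [set v] [set c1] v c1) ?(edge [set c0] [set c1] c0 c1).
rewrite (edge [set v] [set x in c2 :: p] v c2) ?(edge [set c1] [set x in c2 :: p] c1 c2).
rewrite (edge [set c0] [set x in c2 :: p] c0 (last c2 p)).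
all: rewrite ?inE -?in_cons ?mem_last ?[adj _ c0 (last _ _)]adj_sym ?hub ?inE ?eqxx ?orbT //.
by rewrite !andbT !negb_or => /and4P[/and3P[-> -> ->] /andP[-> ->] _ _] /and4P[-> -> -> ->].
Qed.

Lemma nb_forest (V : finType) (H : graph V) (v : V) :
  minor_free (complete_graph 4) H -> is_forest (induced H (nb H v)).
Proof.
move=> K4free c c2; apply/negP => /andP[cyc uc]; apply: K4free.
apply: (@wheel_K4_minor _ _ v c) => //.
  by apply: sub_cycle cyc => x y /and3P[].
by move=> x /(next_cycle cyc) /and3P[]; rewrite in_nb.
Qed.

(** * Graphs without a minor [K_4] are 2-degenerate *)

(* Deleted vertices are kept as isolated ones, so that all minors of H live on
   the same vertex type. *)
Definition core (V : finType) (H : graph V) : Prop :=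
  (exists x, nb H x != set0) /\ (forall x, nb H x != set0 -> 2 < #|nb H x|).

Section MinimalCore.
Variables (V : finType) (H : graph V).
Hypothesis coreH : core H.
Hypothesis minH : forall S c, S != set0 -> S \subset nb H c -> ~ core (contract H S c).
Hypothesis K4free : minor_free (complete_graph 4) H.

Let deg3 x y : adj H x y -> 2 < #|nb H x|.
Proof. by move=> xy; apply: coreH.2; apply/set0Pn; exists y; rewrite in_nb. Qed.

(** The usable form of minimality: [c] itself is outside [S] and keeps a positive degree, so the
    contraction has an edge and only degrees remain to be checked. *)
Let not_core_contract S c : S != set0 -> S \subset nb H c ->
  ~ (forall x, x \notin S -> nb H x != set0 -> 2 < #|nb (contract H S c) x|).
Proof.
move=> S0 Sc deg; apply: (minH S0 Sc).
split=> [|x /set0Pn[y]]; last first.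
  by rewrite in_nb => /(contract_support Sc)[]; apply: deg.
exists c; rewrite -card_gt0; apply: leq_trans (deg c _ _) => //.
  by apply/negP => /(subsetP Sc); rewrite in_nb adj_irr.
by apply: contraNneq S0 => c0; rewrite c0 subset0 in Sc.
Qed.

(* Otherwise contracting uv keeps all degrees at least 3. *)
Lemma edge_triangle u v : adj H u v ->
  #|nb H u :&: nb H v| <= 1 -> exists2 w, w \in nb H u :&: nb H v & #|nb H w| <= 3.
Proof.
move=> uv c1; apply: contrapT => large.
have vu : adj H v u by rewrite adj_sym.
have sub_vu : [set v] \subset nb H u by rewrite sub1set in_nb.
apply: (not_core_contract (c := u) _ sub_vu) => [|x].
  by apply/set0Pn; exists v; rewrite set11.
rewrite inE => xv /coreH.2 dx.
have [->|xu] := eqVneq x u.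
  (* The merged vertex keeps N(u) and N(v) apart from [u] and [v] themselves: at least 3 + 3 - 1 - 2
     = 3 neighbours. *)
  have sub : (nb H u :|: nb H v) :\ u :\ v \subset nb (contract H [set v] u) u.
    apply/subsetP => y; rewrite !inE -/(nb _ _) => /and3P[yv yu /orP[uy|vy]].
      by apply: contract_adj; rewrite ?inE // eq_sym; apply: contraTneq uv => ->; rewrite adj_irr.
    rewrite adj_sym; apply: (contract_adj_centre (s := v)); rewrite ?inE //.
    by rewrite adj_sym.
  apply: leq_trans (subset_leq_card sub).
  have := cardsD1 u (nb H u :|: nb H v); have := cardsD1 v ((nb H u :|: nb H v) :\ u).
  have := cardsUI (nb H u) (nb H v); have := deg3 uv; have := deg3 vu.
  do 2!case: (_ \in _) => /=; lia.
have [xadjv|xNv] := boolP (adj H x v); last first.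
  apply: leq_trans dx (subset_leq_card _).
  apply: subset_trans (contract_edges sub_vu _); last by rewrite inE.
  by rewrite subsetD subxx disjoint_sym disjoints1 in_nb xNv.
have xS : x \notin [set v] by rewrite inE.
have := subset_leq_card (contract_edges_centre sub_vu xS xu (set11 v) xadjv).
apply: leq_trans; rewrite cardsU1 !inE.
have := cardsD1 v (nb H x); rewrite in_nb xadjv.
(* Trading [v] for [u] costs a neighbour only if [x] is a common neighbour, and then [large] gives
   it degree at least 4. *)
have [xadju|_] := boolP (adj H x u); last by rewrite andbF; lia.
have : 3 < #|nb H x|.
  rewrite ltnNge; apply/negP => dx3; apply: large; exists x => //.
  by rewrite !inE !(adj_sym H _ x) xadju.
lia.
Qed.

Lemma triangle u v : adj H u v -> exists2 w, adj H u w & adj H v w.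
Proof.
move=> uv; have [c1|c2] := leqP #|nb H u :&: nb H v| 1.
  by have [w] := edge_triangle uv c1; rewrite !inE => /andP[]; exists w.
have /card_gt0P[w] := ltnW c2; rewrite !inE => /andP[]; by exists w.
Qed.

(* Then N(b) = {w, a, c}, while a and c have degree at least 4, so contracting
   {a, b, w} to a single vertex keeps all degrees at least 3. *)
Lemma no_diamond w a b c :
  nb H w = [set a; b; c] -> adj H a b -> adj H b c -> a != c -> ~~ adj H a c -> False.
Proof.
move=> Nw ab bc ac nac.
have ba : adj H b a by rewrite adj_sym.
have cb : adj H c b by rewrite adj_sym.
have wa : adj H w a by rewrite -in_nb Nw !inE eqxx.
have wb : adj H w b by rewrite -in_nb Nw !inE eqxx orbT.
have wc : adj H w c by rewrite -in_nb Nw !inE eqxx orbT.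
have nca : ~~ adj H c a by rewrite adj_sym.
have neq x y : adj H x y -> x != y by move=> xy; apply: contraTneq xy => ->; rewrite adj_irr.
have Nb : nb H b = [set w; a; c].
  (* The edge [wa] lies in a single triangle, so its apex [b] has degree at most 3. *)
  have I1 : nb H w :&: nb H a = [set b].
    apply/setP => x; rewrite Nw !inE; apply/idP/eqP => [|->]; last by rewrite ab eqxx orbT.
    by case/andP=> /orP[/orP[]|] /eqP-> //; rewrite ?adj_irr // (negPf nac).
  have [] := edge_triangle wa; first by rewrite I1 cards1.
  move=> x; rewrite I1 => /set1P-> db; apply/esym/eqP; rewrite eqEcard.
  have -> : #|[set w; a; c]| = 3.
    by rewrite -setUA !cardsU1 cards1 !inE negb_or ac !neq.
  rewrite db andbT; apply/subsetP => y; rewrite !inE.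
  by case/orP=> [/orP[]|] /eqP-> //; rewrite adj_sym.
have indep x y : x \in [set a; c] -> y \in [set a; c] -> ~~ adj H x y.
  by case/set2P=> -> /set2P[] ->; rewrite ?adj_irr.
have adjS x : x \in [set a; c] -> adj H x w /\ adj H x b.
  by case/set2P=> ->; rewrite ![adj H _ w]adj_sym.
(* The edge from [x] to a third neighbour [z] lies in a triangle, whose apex [t] differs from [w]
   and [b] because [z] is adjacent to neither. *)
have deg4 x : x \in [set a; c] -> 1 < #|nb H x :\: [set w; b]|.
  move=> xac; have [xw xb] := adjS x xac.
  have /card_gt0P[z] : 0 < #|nb H x :\: [set w; b]|.
    rewrite cardsD subn_gt0; apply: leq_ltn_trans (deg3 xw).
    by apply: leq_trans (subset_leq_card (subsetIr _ _)) _; rewrite cards2; case: (_ != _).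
  rewrite !inE negb_or => /andP[/andP[zw zb] xz].
  have zac : z \notin [set a; c] by apply: contraL xz; apply: indep.
  have zNw : ~~ adj H z w.
    by apply: contra zac; rewrite adj_sym -in_nb Nw !inE (negPf zb) orbF.
  have zNb : ~~ adj H z b.
    by apply: contra zac; rewrite adj_sym -in_nb Nb !inE (negPf zw).
  have [t xt zt] := triangle xz.
  have tz : t != z by rewrite eq_sym neq.
  have tw : t != w by apply: contraTneq zt => ->.
  have tb : t != b by apply: contraTneq zt => ->.
  by rewrite (cardsD1 t) (cardsD1 z) !inE xt xz (negPf zw) (negPf zb) (negPf tw) (negPf tb) eq_sym tz.
have sub_Sa : [set w; b] \subset nb H a.
  by apply/subsetP => x /set2P[]->; rewrite in_nb // adj_sym.
have aS : a \notin [set w; b] by rewrite !inE negb_or eq_sym !neq.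
have cS : c \notin [set w; b] by rewrite !inE negb_or eq_sym !neq.
have ca : c != a by rewrite eq_sym.
have wS : w \in [set w; b] by rewrite set21.
have cw : adj H c w by rewrite adj_sym.
apply: (not_core_contract _ sub_Sa) => [|x xS /coreH.2 dx]; first by apply/set0Pn; exists w.
(* Through [w] the vertices [a] and [c] become adjacent: each gains the other beside the two
   neighbours given by [deg4]. *)
have [->|xa] := eqVneq x a.
  have sub : c |: (nb H a :\: [set w; b]) \subset nb (contract H [set w; b] a) a.
    rewrite subUset contract_edges // andbT sub1set in_nb adj_sym.
    exact: contract_adj_centre cw.
  apply: leq_trans (subset_leq_card sub).
  by rewrite cardsU1 !inE (negPf nac) andbF; apply: deg4; rewrite set21.
have [->|xc] := eqVneq x c.
  apply: leq_trans (subset_leq_card (contract_edges_centre sub_Sa cS ca wS cw)).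
  by rewrite cardsU1 !inE (negPf nca) andbF; apply: deg4; rewrite set22.
(* Any other vertex has no neighbour among [w] and [b], so it loses nothing. *)
apply: leq_trans dx (subset_leq_card _); apply: subset_trans (contract_edges sub_Sa xS).
rewrite subsetD subxx; apply/pred0P => y /=; rewrite !inE; apply/negP => /andP[xy].
move: xS; rewrite !inE negb_or => /andP[xw xb].
case/orP=> /eqP yE; move: xy; rewrite yE adj_sym -in_nb ?Nw ?Nb !inE.
  by rewrite (negPf xa) (negPf xb) (negPf xc).
by rewrite (negPf xa) (negPf xw) (negPf xc).
Qed.

Lemma minimal_core_absurd : False.
Proof.
have [x /set0Pn[y]] := coreH.1; rewrite in_nb => xy.
have Nx0 : nb H x != set0 by apply/set0Pn; exists y; rewrite in_nb.
have [u] := forest_degenerate (induced_sym H _) (@induced_irr _ _ _) (@nb_forest _ _ x K4free) (subxx (nb H x)) Nx0.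
rewrite in_nb => xu du.
have {}du : #|nb H x :&: nb H u| <= 1.
  apply: leq_trans du; apply/subset_leq_card/subsetP => z; rewrite !inE => /andP[xz uz].
  by rewrite /induced /= !in_nb xu xz uz.
have [w] := edge_triangle xu du; rewrite !inE => /andP[xw uw] dw.
have wx : adj H w x by rewrite adj_sym.
have wu : adj H w u by rewrite adj_sym.
have {dw} /cards1P[t tP] : #|nb H w :\ x :\ u| == 1.
  have ux : u != x by apply: contraTneq xu => ->; rewrite adj_irr.
  have := deg3 wx; have := cardsD1 x (nb H w); have := cardsD1 u (nb H w :\ x).
  by rewrite !inE wx wu ux; lia.
have : t \in nb H w :\ x :\ u by rewrite tP set11.
rewrite !inE => /and3P[tu tx wt].
have Nw z : (z \in nb H w) = [|| z == u, z == x | z == t].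
  rewrite -[z == t]in_set1 -tP !in_setD1.
  by have [->|_] := eqVneq z u; last have [->|_] := eqVneq z x; rewrite /= ?in_nb.
(* Otherwise [u] would have the two neighbours [w] and [t] within N(x). *)
have notboth : adj H t x -> ~~ adj H t u.
  move=> tadjx; apply/negP => tadju; move: du; rewrite leqNgt => /negP; apply.
  have tw : t != w by apply: contraTneq wt => ->; rewrite adj_irr.
  rewrite (cardsD1 w) (cardsD1 t) !inE xw uw tw /=.
  by rewrite !(adj_sym H _ t) tadjx tadju.
(* The apex of a triangle on [wt] lies in N(w) = {u, x, t}, hence is [u] or [x]; it is the middle
   vertex of the path induced by N(w). *)
have [z] := triangle wt; rewrite -in_nb Nw => /or3P[] /eqP->; last by rewrite adj_irr.
  move=> tadju; apply: (@no_diamond w x u t) => //; rewrite 1?adj_sym //.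
  - by apply/setP => s; rewrite Nw !inE; do 3!case: (s == _).
  - by rewrite eq_sym.
  by apply/negP => /notboth; rewrite tadju.
move=> tadjx; apply: (@no_diamond w u x t) => //; rewrite 1?adj_sym //.
- by apply/setP => s; rewrite Nw !inE; do 3!case: (s == _).
- by rewrite eq_sym.
exact: notboth.
Qed.

End MinimalCore.

(** Induction on the number of non-isolated vertices: a contraction that is a core would have a K_4
    minor, and so would [H]. Without such a minor [H] is therefore minimal in the sense of
    [minimal_core_absurd]. *)
Lemma core_K4_minor (V : finType) (H : graph V) :
  core H -> has_minor H (complete_graph 4).
Proof.
move: {2}#|[set x | nb H x != set0]| (leqnn #|[set x | nb H x != set0]|) => n.
elim: n H => [|n IHn] H le_n coreH.
  have [[x x0] _] := coreH; move: le_n; rewrite leqn0 cards_eq0 => /eqP/setP/(_ x).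
  by rewrite !inE x0.
apply: contrapT => K4free; apply: (minimal_core_absurd coreH) => // S c S0 Sc coreC.
apply: K4free; apply: (contract_minor Sc).
  move=> w; have [->|] := eqVneq w ord0; first by exists ord_max.
  by exists ord0.
apply: IHn coreC; rewrite -ltnS; apply: leq_trans le_n; apply: proper_card.
apply/properP; split.
  apply/subsetP => x; rewrite !inE => /set0Pn[y]; rewrite in_nb.
  by case/(contract_support Sc).
have [s sS] := set0Pn _ S0; exists s; rewrite !inE.
  by apply/set0Pn; exists c; rewrite in_nb adj_sym -in_nb (subsetP Sc).
rewrite negbK; apply/eqP/setP => y; rewrite in_nb inE; apply/negP.
by case/(contract_support Sc); rewrite sS.
Qed.

(** A set [B] violating degeneracy makes the subgraph induced by [B], with all other vertices
    isolated, a core. *)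
Lemma K4_minor_free_degenerate (V : finType) (H : graph V) (A : {set V}) :
  minor_free (complete_graph 4) H -> degenerate (adj H) 2 A.
Proof.
move=> K4free B _ /set0Pn[x0 x0B]; apply: contrapT => large.
pose HB := Graph (induced_sym H B) (@induced_irr _ H B).
have nbB x : x \in B -> nb HB x = nbr (adj H) B x.
  by move=> xB; apply/setP => y; rewrite !inE [LHS]/(induced H B x y) /induced /= xB.
have deg x : x \in B -> 2 < #|nb HB x|.
  by move=> xB; rewrite nbB // ltnNge; apply/negP => dx; apply: large; exists x.
apply: K4free; apply: (@has_minor_sub _ _ HB); first by move=> x y /and3P[].
apply: core_K4_minor; split; first by exists x0; rewrite -card_gt0; apply: ltnW (ltnW (deg _ x0B)).
by move=> x /set0Pn[y]; rewrite in_nb => /and3P[xB _ _]; apply: deg.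
Qed.

(** * Greedy colouring *)

Local Open Scope ring_scope.

(** A sign is its own inverse, so a constraint need only be checked from one end of the edge. *)
Lemma colour_conflict_sym (V : finType) (G : signed_graph V) (phi : V -> int) u v :
  adj (underlying G) u v -> phi u <> sigma G [set u; v] * phi v ->
  phi v <> sigma G [set v; u] * phi u.
Proof.
rewrite -mem_edges => /sigmaP; rewrite (setUC [set v]).
by case=> ->; rewrite ?mul1r ?mulN1r => neq E; apply: neq; rewrite E ?opprK.
Qed.

Lemma greedy_colouring (V : finType) (G : signed_graph V) (d : nat)
    (s : seq int) (A : {set V}) :
    uniq s -> (d < size s)%N -> degenerate (adj (underlying G)) d A ->
  exists phi : V -> int, (forall v, phi v \in s) /\
    {in A &, forall u v, adj (underlying G) u v -> phi u <> sigma G [set u; v] * phi v}.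
Proof.
move=> us ds; move: {2}#|A| (leqnn #|A|) => n.
elim: n A => [|n IHn] A leAn degA.
  have A0 : A = set0 by apply/eqP; rewrite -cards_eq0 -leqn0.
  exists (fun=> s`_0); split=> [v|u v]; last by rewrite A0 inE.
  by rewrite mem_nth //; apply: leq_trans ds.
have [A0|A0] := eqVneq A set0; first by apply: IHn degA; rewrite A0 cards0.
have [v vA dv] := degA A (subxx A) A0.
have [||phi [phis propphi]] := IHn (A :\ v).
- by have := cardsD1 v A; rewrite vA; lia.
- by move=> B BA; apply: degA; apply: subset_trans BA (subsetDl _ _).
(* One forbidden value per neighbour of [v] in [A], hence at most [d], fewer than the colours in
   [s]. *)
pose forbidden := [seq sigma G [set v; u] * phi u | u in nbr (adj (underlying G)) A v].
have [c cs cfree] : exists2 c, c \in s & c \notin forbidden.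
  apply: contrapT => all_forbidden.
  have : (size s <= size forbidden)%N.
    apply: uniq_leq_size us _ => c cs; apply: contrapT => /negP cN.
    by apply: all_forbidden; exists c.
  by rewrite size_image; lia.
exists (fun x => if x == v then c else phi x); split=> [x|x y xA yA xy].
  by case: ifP.
have ok u : u \in A -> adj (underlying G) v u -> c <> sigma G [set v; u] * phi u.
  move=> uA vu cE; move: cfree; rewrite cE => /negP; apply; apply: image_f.
  by rewrite inE uA.
have [xv|xv] := eqVneq x v; have [yv|yv] := eqVneq y v.
- by move: xy; rewrite xv yv adj_irr.
- by move: xy; rewrite xv => vy; apply: ok.
- have vx : adj (underlying G) v x by rewrite adj_sym -yv.
  have vNx : (x == v) = false by apply/negbTE.
  have := @colour_conflict_sym _ _ (fun x => if x == v then c else phi x) v x vx.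
  by rewrite /= eqxx vNx yv; apply; apply: ok.
by apply: propphi xy; rewrite !inE ?xv ?yv.
Qed.

(** * From degeneracy and arboricity to the chromatic number *)

Lemma chromatic_number_le (V : finType) (G : signed_graph V) (n : nat) :
  colourable G n -> (chromatic_number G <= n)%N.
Proof. by have [_] := leastP (colourable_ex G); apply. Qed.

Lemma degenerate_colourable (V : finType) (G : signed_graph V) (d : nat) :
    (d < size (colours d.+1))%N -> uniq (colours d.+1) ->
    degenerate (adj (underlying G)) d [set: V] -> colourable G d.+1.
Proof.
move=> ds us /(greedy_colouring us ds)[phi [phis propphi]]; split=> //.
by exists phi; split=> // u v uv; apply: propphi; rewrite ?inE.
Qed.

Lemma degenerateW (V : finType) (e : rel V) (d d' : nat) (A : {set V}) :
  (d <= d')%N -> degenerate e d A -> degenerate e d' A.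
Proof.
move=> dd' deg B BA B0; have [v vB dv] := deg B BA B0.
by exists v => //; apply: leq_trans dv dd'.
Qed.

Lemma degenerate_induced (V : finType) (H : graph V) (d : nat) (A : {set V}) :
  degenerate (induced H A) d A -> degenerate (adj H) d A.
Proof.
move=> deg B BA B0; have [v vB dv] := deg B BA B0; exists v => //.
apply: leq_trans dv; apply/subset_leq_card/subsetP => y; rewrite !inE /induced /=.
by case/andP=> yB ->; rewrite yB !(subsetP BA).
Qed.

Lemma mem_colours_double (k i : nat) (x : int) :
  (0 < i <= k)%N -> x \in [:: i%:Z; - i%:Z] -> x \in colours (2 * k).
Proof.
move=> /andP[i0 ik] xi; rewrite /colours mul2n odd_double doubleK.
apply/flattenP; exists [:: i%:Z; - i%:Z] => //.
by apply: map_f; rewrite mem_iota i0 add1n.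
Qed.

(** Two colours suffice on each 1-degenerate part; colours of different parts differ in absolute
    value, so no sign can make them conflict. *)
Lemma vertex_forests_colourable (V : finType) (G : signed_graph V) (m k : nat) :
    (0 < k)%N -> (m <= k)%N -> vertex_forest_partition (underlying G) m ->
  colourable G (2 * k).
Proof.
move=> k0 mk [P [partP cP forP]]; split; first by rewrite muln_gt0.
(* Counting from 1 keeps [idx A] and its negative distinct. *)
pose idx A := (index A (enum P)).+1.
have /choice[phi phiP] : forall A : {set V}, exists phi : V -> int, A \in P ->
    (forall v, phi v \in [:: (idx A)%:Z; - (idx A)%:Z]) /\
    {in A &, forall u v, adj (underlying G) u v -> phi u <> sigma G [set u; v] * phi v}.
  move=> A; have [AP|] := boolP (A \in P); last by exists (fun=> 0).
  have deg := degenerate_induced (forest_degenerate (A := A) (induced_sym _ A) (@induced_irr _ _ _) (forP A AP)).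
  have us : uniq [:: (idx A)%:Z; - (idx A)%:Z] by [].
  by have [phi phiP] := greedy_colouring us (isT : (1 < 2)%N) deg; exists phi.
have cov v : v \in cover P by rewrite (cover_partition partP) inE.
have blk v : pblock P v \in P by rewrite pblock_mem.
have absphi v : `|phi (pblock P v) v|%N = idx (pblock P v).
  have := (phiP _ (blk v)).1 v; rewrite !inE => /orP[] /eqP->; lia.
exists (fun v => phi (pblock P v) v); split=> [u v uv|v].
  have [same|diff] := eqVneq (pblock P u) (pblock P v).
    rewrite same; apply: (phiP _ (blk v)).2 => //; last by rewrite mem_pblock.
    by rewrite -same mem_pblock.
  move=> /(congr1 absz); rewrite abszM !absphi.
  have -> : `|sigma G [set u; v]|%N = 1%N.
    by case: (@sigmaP _ G [set u; v]) => [|->|->] //; rewrite mem_edges.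
  rewrite mul1n => -[] /(congr1 (nth set0 (enum P))).
  by rewrite !nth_index ?mem_enum // => eqb; rewrite eqb eqxx in diff.
apply: (mem_colours_double _ ((phiP _ (blk v)).1 v)).
by rewrite /= (leq_trans _ mk) // -cP cardE index_mem mem_enum.
Qed.

Local Close Scope ring_scope.

Theorem proposition2p4 (V : finType) (V_nonempty : 0 < #|V|)
    (G : signed_graph V) :
  [/\ minor_free (complete_graph 4) (underlying G) -> chromatic_number G <= 3,
      edge_arboricity (underlying G) <= 2 -> chromatic_number G <= 4 &
      forall k : nat, 1 <= k ->
        vertex_arboricity (underlying G) <= k -> chromatic_number G <= 2 * k].
Proof.
split=> [K4free|arb|k k0 arb]; apply: chromatic_number_le.
- by apply: degenerate_colourable => //; apply: K4_minor_free_degenerate.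
- apply: degenerate_colourable => //.
  have [/(edge_forests_degenerate (A := setT)) deg _] := leastP (edge_forest_partition_ex (underlying G)).
  (* With m <= 2 forests, 2m - 1 <= 3. *)
  by apply: degenerateW deg; move: arb; rewrite /edge_arboricity; lia.
have [part _] := leastP (vertex_forest_partition_ex (underlying G)).
exact: vertex_forests_colourable arb part.
Qed.
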